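(* In the case $\alpha=1$, for any $-1<\theta<1$ and any $-1<x<1$, the series $$\frac{1-\theta}{2}+\frac{1}{\pi}\sum_{n=0}^{\infty}\frac{x^{n+1}}{n+1}\sin\left(\tfrac{\pi}{2}(n+1)(1-\theta)\right)$$ converges to the distribution function $$G(x,1,\theta)=\frac{1}{2}+\frac{1}{\pi}\arctan\left(\frac{x-\sin\left(\frac{\pi}{2}\theta\right)}{\cos\left(\frac{\pi}{2}\theta\right)}\right).$$
   Context: The function $G(x,1,\theta)$ displayed in the claim is the distribution function of the standard strictly stable law with $\alpha=1$ (the asymmetric Cauchy distribution), i.e. the law with characteristic function $\exp\{-|t|\exp\{-i\tfrac{\pi}{2}\theta\,\mathrm{sign}\,t\}\}$, $t\in\mathbf{R}$. *)

(* Defs.v *)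
From HB Require Import structures.
From mathcomp Require Import all_boot all_order all_algebra.
From mathcomp Require Import all_classical all_reals all_analysis.
From mathcomp Require Import complex.

Set Implicit Arguments.
Unset Strict Implicit.
Unset Printing Implicit Defensive.

Import Order.TTheory GRing.Theory Num.Theory.
Import numFieldNormedType.Exports.

Local Open Scope ring_scope.
Local Open Scope complex_scope.

Definition cexp (R : realType) (z : R[i]) : R[i] :=
  (expR (complex.Re z))%:C * (cos (complex.Im z) +i* sin (complex.Im z)).

(* Taken componentwise; [fine] loses nothing when both components are
   integrable, as in [charfun], where they are bounded and measurable. *)
Definition cexpectation (d : measure_display) (T : measurableType d)
    (R : realType) (P : probability T R) (Z : T -> R[i]) : R[i] :=
  fine ('E_P[fun w => complex.Re (Z w)])%E +i*
  fine ('E_P[fun w => complex.Im (Z w)])%E.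

Definition charfun (d : measure_display) (T : measurableType d)
    (R : realType) (P : probability T R) (X : {RV P >-> R}) (t : R) : R[i] :=
  cexpectation P (fun w => cexp ('i * (t * X w)%:C)).

Definition stable1_charfun (R : realType) (theta t : R) : R[i] :=
  cexp (- (`|t|%:C * cexp (- ('i * (pi / 2 * theta * Num.sg t)%:C)))).

Definition stable1_df (R : realType) (theta x : R) : R :=
  2^-1 + pi^-1 * atan ((x - sin (pi / 2 * theta)) / cos (pi / 2 * theta)).

(* Main.v *)
Require Import Defs.
From HB Require Import structures.
From mathcomp Require Import all_boot all_order all_algebra.
From mathcomp Require Import all_classical all_reals all_analysis.
From mathcomp Require Import measurable_realfun complex.
From mathcomp Require Import ring lra.

Import Order.TTheory GRing.Theory Num.Theory.
Import numFieldNormedType.Exports.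

Local Open Scope classical_set_scope.
Local Open Scope ring_scope.

(** For [|r| < 1] one has
      [\sum_(n >= 1) r^n sin(n phi) / n = atan (r sin phi / (1 - r cos phi))]:
    the [r]-derivative of the partial sum is a geometric sum of sines, so the
    error has an explicit derivative of size [O(r^N)], uniformly in [phi].
    With [phi = pi / 2 * (1 - theta)] the right-hand side is the arctangent of
    the statement up to the constant [pi / 2 * theta], as both sides have the
    same derivative.

    The same series replaces Fourier inversion.  Let [c = cos (pi/2 theta)] and
    [s = sin (pi/2 theta)].  Integrating it term by term at
    [phi = h (X - u)], the characteristic function turns [r] into
    [r e^(-ch)] and [X] into [s].  With [r = e^(-eps h)] and [h -> 0] this
    yields [E atan((X - u)/eps) = atan((s - u)/(eps + c))].  Finally let
    [eps -> 0] while [u] is approached from the right more slowly: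
    the left-hand side tends to [pi/2 - pi P(X <= u)]. *)

(** * The sine series and its closed form *)

(** For [|r| < 1] this is the imaginary part of -log(1 - r e^(i phi)); [poisson_sum] gives the
    partial sums of its Taylor series in [r]. *)
Definition poisson_atan {R : realType} (r phi : R) : R :=
  atan (r * sin phi / (1 - r * cos phi)).

Definition poisson_sum {R : realType} (r phi : R) (N : nat) : R :=
  \sum_(0 <= n < N) (r ^+ n.+1 / n.+1%:R * sin (n.+1%:R * phi)).

Lemma sin_recurrence {R : realType} (phi : R) (n : nat) :
  sin (n.+2%:R * phi) =
  2 * cos phi * sin (n.+1%:R * phi) - sin (n%:R * phi).
Proof.
have -> : n.+2%:R * phi = n.+1%:R * phi + phi by rewrite -natr1; ring.
have -> : n%:R * phi = n.+1%:R * phi - phi by rewrite -natr1; ring.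
by rewrite sinD sinB; ring.
Qed.

(** By [sin_recurrence], multiplying by the quadratic makes the sum telescope. The division-free
    form is valid for every [r]. *)
Lemma sum_expr_sin {R : realType} (r phi : R) (N : nat) :
  (\sum_(0 <= n < N) (r ^+ n * sin (n.+1%:R * phi)))
    * (1 - 2 * r * cos phi + r ^+ 2) =
  sin phi - r ^+ N * (sin (N.+1%:R * phi) - r * sin (N%:R * phi)).
Proof.
elim: N => [|N IH].
  by rewrite big_nil !mul0r sin0 expr0 mul1r mulr0 subr0 mul1r subrr.
rewrite big_nat_recr //= mulrDl IH sin_recurrence [r ^+ N.+1]exprS; ring.
Qed.

Lemma poisson_denom_gt0 {R : realType} (r phi : R) :
  `|r| < 1 -> 0 < 1 - r * cos phi.
Proof.
move=> r1; rewrite subr_gt0; apply: le_lt_trans (ler_norm _) _.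
rewrite normrM; apply: le_lt_trans r1.
by rewrite ler_piMr // ler_norml cos_geN1 cos_le1.
Qed.

(** The quadratic is |1 - r e^(i phi)|^2, so this is the reverse triangle inequality; the bound does
    not depend on [phi]. *)
Lemma poisson_quad_ge {R : realType} (r phi : R) :
  `|r| < 1 -> (1 - `|r|) ^+ 2 <= 1 - 2 * r * cos phi + r ^+ 2.
Proof.
move=> r1; have h : r * cos phi <= `|r|.
  apply: le_trans (ler_norm _) _; rewrite normrM ler_piMr //.
  by rewrite ler_norml cos_geN1 cos_le1.
have -> : (1 - `|r|) ^+ 2 = 1 - 2 * `|r| + r ^+ 2.
  by rewrite -(real_normK (num_real r)); ring.
by lra.
Qed.

Lemma poisson_quad_gt0 {R : realType} (r phi : R) :
  `|r| < 1 -> 0 < 1 - 2 * r * cos phi + r ^+ 2.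
Proof.
move=> r1; apply: lt_le_trans (poisson_quad_ge r phi r1).
by rewrite exprn_gt0 // subr_gt0.
Qed.

Lemma is_derive_poisson_atan {R : realType} (r phi : R) : `|r| < 1 ->
  is_derive r 1 (fun t => poisson_atan t phi)
    (sin phi / (1 - 2 * r * cos phi + r ^+ 2)).
Proof.
move=> r1; have d0 := poisson_denom_gt0 r phi r1.
have q0 := poisson_quad_gt0 r phi r1.
pose f t : R := t * sin phi; pose g t : R := 1 - t * cos phi.
have df : is_derive r 1 f (sin phi).
  by rewrite /f; apply: is_derive_eq; rewrite /= scaler0 add0r; exact: mulr1.
have dg : is_derive r 1 g (- cos phi).
  rewrite /g; apply: is_derive_eq.
  by rewrite /GRing.scale /=; ring.
have g0 : g r != 0 by rewrite /g gt_eqF.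
have dV := is_deriveV g0 dg.
have dM : is_derive r 1 (fun t => f t / g t) _ := is_deriveM df dV.
have dA := is_derive1_atan (f r * (g r)^-1).
have := @is_derive1_comp _ atan (fun t => f t / g t) _ _ _ dA dM.
rewrite /comp /poisson_atan /f /g => h.
apply: (is_derive_eq h); rewrite /GRing.scale /=.
have e : (1 - r * cos phi) ^+ 2 + (r * sin phi) ^+ 2 =
    1 - 2 * r * cos phi + r ^+ 2.
  have /(congr1 (fun z => r ^+ 2 * z)) := cos2Dsin2 phi; lra.
rewrite -e in q0 *.
by field; rewrite !gt_eqF.
Qed.

Lemma is_derive_poisson_sum {R : realType} (r phi : R) (N : nat) :
  is_derive r 1 (fun t => poisson_sum t phi N)
    (\sum_(0 <= n < N) (r ^+ n * sin (n.+1%:R * phi))).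
Proof.
elim: N => [|N IH].
  rewrite big_nil /poisson_sum.
  under eq_fun do rewrite big_nil; exact: is_derive_cst.
rewrite /poisson_sum; under eq_fun do rewrite big_nat_recr //=.
rewrite big_nat_recr //=; apply: is_deriveD.
have N0 : N.+1%:R != 0 :> R by [].
have dX : is_derive r 1 (fun t => t ^+ N.+1) (N.+1%:R * r ^+ N).
  by apply: DeriveDef; [exact: exprn_derivable | rewrite exp_derive [LHS]mulr1].
have h := is_deriveZ (sin (N.+1%:R * phi) / N.+1%:R) dX.
have -> : (fun t => t ^+ N.+1 / N.+1%:R * sin (N.+1%:R * phi)) =
    (sin (N.+1%:R * phi) / N.+1%:R) \*: (fun t => t ^+ N.+1).
  by apply/funext => t /=; rewrite /GRing.scale /=; ring.
by apply: (is_derive_eq h); rewrite /GRing.scale /=; field.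
Qed.

(** Mean value inequality on the segment between 0 and [x], for either sign of [x]. The hypotheses
    stay within [|t| <= |x|] because the derivatives it is applied to are known only for
    [|t| < 1]. *)
Lemma norm_le_derive_bound {R : realType} (f df : R -> R) (x K : R) :
  (forall t : R, `|t| <= `|x| -> is_derive t 1 f (df t)) ->
  (forall t : R, `|t| <= `|x| -> `|df t| <= K) ->
  `|f x - f 0| <= K * `|x|.
Proof.
move=> fdf dfK.
have seg a b : a <= b -> (forall t, t \in `[a, b]%R -> `|t| <= `|x|) ->
    `|f b - f a| <= K * (b - a).
  move=> ab tx; have [||t /tx ht ->] := @MVT_segment _ f df a b ab.
  - by move=> t /subset_itv_oo_cc/tx; exact: fdf.
  - by apply: derivable_within_continuous => t /tx /fdf [].
  rewrite normrM [X in _ * X]ger0_norm ?subr_ge0 //.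
  by rewrite ler_wpM2r ?dfK // subr_ge0.
have [x0|/ltW x0] := leP 0 x.
  have := seg _ _ x0; rewrite ger0_norm // subr0; apply=> t.
  by rewrite in_itv /= => /andP[t0 tx]; rewrite ger0_norm.
have := seg _ _ x0; rewrite sub0r ler0_norm // distrC; apply=> t.
by rewrite in_itv /= => /andP[xt t0]; rewrite ler0_norm // lerN2.
Qed.

(** Both functions vanish at [r = 0], and the derivative of their difference is just the tail of the
    geometric sum. Uniformity in [phi] later allows a random angle. *)
Lemma poisson_sum_error {R : realType} (r phi : R) (N : nat) : `|r| < 1 ->
  `|poisson_sum r phi N - poisson_atan r phi|
    <= 2 / (1 - `|r|) ^+ 2 * `|r| ^+ N.
Proof.
move=> r1.
pose f t := poisson_sum t phi N - poisson_atan t phi.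
pose df t := - (t ^+ N * (sin (N.+1%:R * phi) - t * sin (N%:R * phi)))
  / (1 - 2 * t * cos phi + t ^+ 2).
have f0 : f 0 = 0.
  rewrite /f /poisson_sum /poisson_atan !mul0r atan0 subr0 big1 // => i _.
  by rewrite expr0n /= !mul0r.
have fdf (t : R) : `|t| <= `|r| -> is_derive t 1 f (df t).
  move=> /le_lt_trans/(_ r1) t1.
  have h := is_deriveB (is_derive_poisson_sum t phi N)
                       (is_derive_poisson_atan t phi t1).
  apply: (is_derive_eq h); rewrite /df.
  have q0 := gt_eqF (poisson_quad_gt0 t phi t1).
  apply: (mulIf (negbT q0)); rewrite mulrBl sum_expr_sin !divfK ?q0 //; ring.
have dfK t : `|t| <= `|r| -> `|df t| <= 2 / (1 - `|r|) ^+ 2 * `|r| ^+ N.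
  move=> tr; have t1 := le_lt_trans tr r1.
  have q0 := poisson_quad_gt0 t phi t1.
  have r0 : 0 < 1 - `|r| by rewrite subr_gt0.
  rewrite /df normrM normrN normfV (gtr0_norm q0) normrM normrX.
  rewrite -mulrA [leRHS]mulrC; apply: ler_pM.
  - by rewrite exprn_ge0.
  - by rewrite mulr_ge0 // invr_ge0 ltW.
  - by rewrite lerXn2r ?nnegrE.
  apply: ler_pM => //; first by rewrite invr_ge0 ltW.
    (* The constant 2 bounds the two sines in the tail, the second having weight [|t| <= 1]. *)
    apply: le_trans (ler_normB _ _) _; rewrite normrM.
    have h1 : `|sin (N.+1%:R * phi)| <= 1 by rewrite ler_norml sin_geN1 sin_le1.
    have h2 : `|sin (N%:R * phi)| <= 1 by rewrite ler_norml sin_geN1 sin_le1.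
    have h3 : `|t| * `|sin (N%:R * phi)| <= 1.
      by rewrite -[leRHS]mulr1; apply: ler_pM => //; exact: ltW.
    by lra.
  rewrite lef_pV2 ?posrE ?exprn_gt0 //.
  apply: le_trans (poisson_quad_ge t phi t1).
  by rewrite lerXn2r ?nnegrE ?lerB // ltW // subr_gt0.
have := norm_le_derive_bound f df r _ fdf dfK; rewrite f0 subr0 => h.
apply: le_trans h _; rewrite ler_piMr ?(ltW r1) //.
by rewrite mulr_ge0 ?exprn_ge0 // divr_ge0 ?exprn_ge0 // subr_ge0 ltW.
Qed.

Lemma cvg_poisson_sum {R : realType} (r phi : R) : `|r| < 1 ->
  poisson_sum r phi N @[N --> \oo] --> poisson_atan r phi.
Proof.
move=> r1; apply/subr_cvg0/norm_cvg0P.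
apply: (@squeeze_cvgr _ _ _ _ (fun=> 0)
  (fun N => 2 / (1 - `|r|) ^+ 2 * `|r| ^+ N)).
- by apply: nearW => N; rewrite normr_ge0 poisson_sum_error.
- exact: cvg_cst.
rewrite -[X in _ --> X](mulr0 (2 / (1 - `|r|) ^+ 2)).
by apply: cvgMr; apply: cvg_expr; rewrite normr_id.
Qed.

(** Both sides have the same derivative in [x], so comparing them at [x = 0] suffices. *)
Lemma poisson_atanE {R : realType} (alpha x : R) :
  - (pi / 2) < alpha < pi / 2 -> `|x| < 1 ->
  poisson_atan x (pi / 2 - alpha) =
    atan ((x - sin alpha) / cos alpha) + alpha.
Proof.
move=> /andP[a1 a2] x1.
have c0 : 0 < cos alpha by apply: cos_gt0_pihalf; rewrite a1.
have cosE : cos (pi / 2 - alpha) = sin alpha.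
  by rewrite cosB cos_pihalf sin_pihalf; ring.
have sinE : sin (pi / 2 - alpha) = cos alpha.
  by rewrite sinB cos_pihalf sin_pihalf; ring.
pose f t := poisson_atan t (pi / 2 - alpha) -
  atan ((t - sin alpha) / cos alpha).
have fdf (t : R) : `|t| <= `|x| -> is_derive t 1 f 0.
  move=> /le_lt_trans/(_ x1) t1.
  have d1 := is_derive_poisson_atan t (pi / 2 - alpha) t1.
  have q0 := poisson_quad_gt0 t (pi / 2 - alpha) t1.
  have d2 : is_derive t 1 (fun t => (t - sin alpha) / cos alpha) (cos alpha)^-1.
    apply: is_derive_eq; rewrite /GRing.scale /=; ring.
  have d3 := @is_derive1_comp _ atan (fun t => (t - sin alpha) / cos alpha) _ _ _
    (is_derive1_atan ((t - sin alpha) / cos alpha)) d2.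
  have h := is_deriveB d1 d3.
  apply: (is_derive_eq h); rewrite cosE sinE in q0 *.
  have e : (cos alpha) ^+ 2 + (t - sin alpha) ^+ 2 =
      1 - 2 * t * sin alpha + t ^+ 2.
    have := cos2Dsin2 alpha; lra.
  by rewrite -e in q0 *; field; rewrite !gt_eqF.
have : `|f x - f 0| <= 0 * `|x|.
  by apply: (norm_le_derive_bound f (fun=> 0) x 0 fdf) => t _; rewrite normr0.
rewrite mul0r normr_le0 subr_eq0 => /eqP.
(* At 0 the second arctangent is atan(-tan alpha), which is [- alpha] because [alpha] lies in the
   principal interval. *)
have -> : f 0 = alpha.
  rewrite /f /poisson_atan !mul0r atan0 !sub0r mulNr atanN opprK.
  by apply: tanK; rewrite in_itv /= a1.
by move=> fx; rewrite -[X in _ = _ + X]fx /f [RHS]addrC subrK.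
Qed.

(** * Bounded random variables and characteristic functions *)

Lemma bounded_integrable {d} {T : measurableType d} {R : realType}
    (P : probability T R) (Y : T -> R) (M : R) :
  measurable_fun setT Y -> (forall w, `|Y w| <= M) ->
  P.-integrable setT (EFin \o Y).
Proof.
move=> mY YM; apply: measurable_bounded_integrable => //.
  by rewrite (le_lt_trans (probability_le1 _ _)) // ltry.
exists M; split; first exact: num_real.
by move=> y My w _; exact: le_trans (YM w) (ltW My).
Qed.

(** Dominated convergence with the constant [M], integrable because [P] is a probability. The limit
    [Z] inherits measurability and the bound from the [Y n]. *)
Lemma bounded_cvg_Rintegral {d} {T : measurableType d} {R : realType}
    (P : probability T R) (Y : nat -> T -> R) (Z : T -> R) (M : R) :
  (forall n, measurable_fun setT (Y n)) ->
  (forall n w, `|Y n w| <= M) ->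
  (forall w, Y n w @[n --> \oo] --> Z w) ->
  \int[P]_w Y n w @[n --> \oo] --> \int[P]_w Z w.
Proof.
move=> mY YM YZ.
have mZ : measurable_fun setT Z.
  by apply: (measurable_fun_cvg mY) => w _; exact: YZ.
have ZM w : `|Z w| <= M.
  have h : `|Y n w| @[n --> \oo] --> `|Z w| by apply: cvg_norm; exact: YZ.
  rewrite -(cvg_lim _ h) //; apply: limr_le.
    by apply/cvg_ex; eexists; exact: h.
  by apply: nearW => n; exact: YM.
have iZ := bounded_integrable P Z M mZ ZM.
apply: fine_cvg; rewrite fineK; last exact: integrable_fin_num.
apply: (@dominated_cvg _ _ _ P setT measurableT (fun n w => (Y n w)%:E)
  (fun w => (Z w)%:E) (fun=> M%:E)) => //.
- by move=> n; apply/measurable_EFinP; exact: mY.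
- by move=> w _; apply: cvg_EFin; [exact: nearW | exact: YZ].
- apply: (bounded_integrable P (fun=> M) M) => // w.
  by rewrite ger0_norm // (le_trans _ (YM 0%N w)).
- by move=> n w _; rewrite lee_fin; exact: YM.
Qed.

Lemma Re_charfun {d} {T : measurableType d} {R : realType}
    (P : probability T R) (X : {RV P >-> R}) (t : R) :
  complex.Re (charfun X t) = \int[P]_w cos (t * X w).
Proof.
rewrite /charfun /cexpectation /= /Rintegral unlock; congr fine.
by apply: eq_integral => w _; rewrite /cexp /=; simpc => /=;
   rewrite expR0 mul1r.
Qed.

Lemma Im_charfun {d} {T : measurableType d} {R : realType}
    (P : probability T R) (X : {RV P >-> R}) (t : R) :
  complex.Im (charfun X t) = \int[P]_w sin (t * X w).
Proof.
rewrite /charfun /cexpectation /= /Rintegral unlock; congr fine.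
by apply: eq_integral => w _; rewrite /cexp /=; simpc => /=;
   rewrite expR0 mul1r.
Qed.

(** For [t > 0] the exponent is -t e^(-i alpha) = -t cos alpha + i t sin alpha, where alpha = (pi/2)
    theta. *)
Lemma stable1_charfunE {R : realType} (theta t : R) : 0 < t ->
  stable1_charfun theta t =
    (expR (- (cos (pi / 2 * theta) * t)) * cos (t * sin (pi / 2 * theta)) +i*
     (expR (- (cos (pi / 2 * theta) * t)) * sin (t * sin (pi / 2 * theta))))%C.
Proof.
move=> t0; rewrite /stable1_charfun gtr0_sg // gtr0_norm // mulr1 /cexp /=.
simpc => /=; rewrite !expR0 !mul1r !cosN !sinN.
by rewrite [t * - _]mulrN cosN sinN opprK [t * cos _]mulrC.
Qed.

Lemma measurable_poisson_sum {d} {T : measurableType d} {R : realType}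
    (Y : T -> R) (r : R) (N : nat) : measurable_fun setT Y ->
  measurable_fun setT (fun w => poisson_sum r (Y w) N).
Proof.
move=> mY; apply: measurable_sum => n.
apply: measurable_funM => //.
apply: measurableT_comp.
  exact: (continuous_measurable_fun (@continuous_sin R)).
exact: measurable_funM.
Qed.

Lemma measurable_poisson_atan {d} {T : measurableType d} {R : realType}
    (Y : T -> R) (r : R) : `|r| < 1 -> measurable_fun setT Y ->
  measurable_fun setT (fun w => poisson_atan r (Y w)).
Proof.
move=> r1 mY; apply: (@measurable_fun_cvg _ _ _ _
  (fun N w => poisson_sum r (Y w) N)) => [N|w _].
  exact: measurable_poisson_sum.
exact: cvg_poisson_sum.
Qed.

Lemma norm_atan_le {R : realType} (y : R) : `|atan y| <= pi / 2.
Proof. by rewrite ler_norml !ltW ?atan_ltpi2 ?atan_gtNpi2. Qed.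

(** A bound free of [N] and [phi], which serves as the dominating constant when [N] tends to
    infinity under the integral. *)
Lemma norm_poisson_sum_le {R : realType} (r phi : R) (N : nat) : `|r| < 1 ->
  `|poisson_sum r phi N| <= 2 / (1 - `|r|) ^+ 2 + pi / 2.
Proof.
move=> r1; rewrite -[poisson_sum r phi N](subrK (poisson_atan r phi)).
apply: le_trans (ler_normD _ _) _; rewrite lerD ?norm_atan_le //.
apply: le_trans (poisson_sum_error _ _ _ r1) _.
rewrite ler_piMr ?exprn_ile1 ?(ltW r1) //.
by rewrite divr_ge0 // exprn_ge0 // subr_ge0 ltW.
Qed.

(** * Limits along 1/(n+1) *)

Lemma cvg_div_harmonic {R : realType} (f : R -> R) (l : R) :
  f 0 = 0 -> is_derive (0 : R) 1 f l ->
  f (n.+1%:R^-1) / n.+1%:R^-1 @[n --> \oo] --> l.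
Proof.
move=> f0 [df <-].
have := cvg_dnbhs_at_right df.
move/cvg_at_rightP => /(_ (fun n => n.+1%:R^-1)) h.
apply: cvg_trans (h _); last first.
  by split => [n|]; [rewrite invr_gt0 | exact: cvg_harmonic].
apply: near_eq_cvg; apply: nearW => n /=.
by rewrite /GRing.scale /= addr0 f0 subr0 mulr1 mulrC.
Qed.

(** A 0/0 limit: at step 0 the numerator and the denominator inside the arctangent vanish, with
    derivatives [y] and [eps]. Dividing both by the step 1/(n+1) gives the quotient of these
    derivatives. *)
Lemma cvg_poisson_atan {R : realType} (eps y : R) : 0 < eps ->
  poisson_atan (expR (- (eps * n.+1%:R^-1))) (n.+1%:R^-1 * y) @[n --> \oo]
    --> atan (y / eps).
Proof.
move=> e0; pose f (t : R) := expR (- (eps * t)) * sin (t * y).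
pose g (t : R) := 1 - expR (- (eps * t)) * cos (t * y).
have df : is_derive (0 : R) 1 f y.
  rewrite /f; apply: is_derive_eq.
  rewrite /GRing.scale /= !mulr0 !mul0r oppr0 expR0 sin0 cos0; ring.
have dg : is_derive (0 : R) 1 g eps.
  rewrite /g; apply: is_derive_eq.
  rewrite /GRing.scale /= !mulr0 !mul0r oppr0 expR0 sin0 cos0; ring.
have f0 : f 0 = 0 by rewrite /f mul0r sin0 mulr0.
have g0 : g 0 = 0 by rewrite /g mulr0 mul0r oppr0 expR0 cos0 mulr1 subrr.
have hf := cvg_div_harmonic f y f0 df.
have hg := cvg_div_harmonic g eps g0 dg.
have hq : f n.+1%:R^-1 / n.+1%:R^-1 / (g n.+1%:R^-1 / n.+1%:R^-1)
    @[n --> \oo] --> y / eps.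
  by apply: cvgM => //; apply: cvgV => //; rewrite gt_eqF.
have := cvg_comp _ _ hq (@continuous_atan _ _).
apply: cvg_trans; apply: near_eq_cvg; apply: nearW => n.
rewrite /poisson_atan -/(f _) -/(g _); congr atan.
by rewrite invfM mulrACA mulfV ?mulr1 // !invr_eq0.
Qed.

Lemma cvg_linear_pinfty {R : realType} (k : R) (a : nat -> R) : 0 < k ->
  (\forall n \near \oo, k * n.+1%:R <= a n) -> a n @[n --> \oo] --> +oo.
Proof.
move=> k0 ka; apply: ger_cvgy ka _.
apply/cvgryPge => A; near=> n.
rewrite mulrC -ler_pdivrMr //.
have : A / k <= n%:R by near: n; exact: nbhs_infty_ger.
by move=> /le_trans; apply; rewrite ler_nat.
Unshelve. all: by end_near. Qed.

(* The shift [1/(n+1)] dominates the scale [1/(n+1)^2], which decides the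
   limit at [y = 0]. *)
Lemma cvg_atan_step {R : realType} (y : R) :
  atan ((y - n.+1%:R^-1) / n.+1%:R^-1 ^+ 2) @[n --> \oo] -->
    (if y <= 0 then - (pi / 2) else pi / 2).
Proof.
have [y0|y0] := leP y 0.
  suff h : - ((y - n.+1%:R^-1) / n.+1%:R^-1 ^+ 2) @[n --> \oo] --> +oo.
    under eq_fun do rewrite -[X in atan X]opprK atanN.
    by apply: cvgN; exact: cvg_comp h (@cvgy_atan R).
  apply: (cvg_linear_pinfty 1) => //; apply: nearW => n.
  rewrite mul1r -mulNr ler_pdivlMr ?exprn_gt0 ?invr_gt0 //.
  by rewrite expr2 mulrA divff // mul1r opprB lerBrDr gerDl.
apply: cvg_comp (@cvgy_atan R).
apply: (cvg_linear_pinfty (y / 2)); first by rewrite divr_gt0.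
(* Once 1/(n+1) <= y/2, the numerator is at least y/2 and the quotient at least (y/2)(n+1)^2. *)
near=> n.
have h : n.+1%:R^-1 <= y / 2.
  near: n; have y2 : 0 < y / 2 by rewrite divr_gt0.
  by apply: filterS (near_infty_natSinv_lt (PosNum y2)) => m /ltW.
rewrite ler_pdivlMr ?exprn_gt0 ?invr_gt0 //.
have -> : y / 2 * n.+1%:R * n.+1%:R^-1 ^+ 2 = y / 2 / n.+1%:R.
  by have N0 : n.+1%:R != 0 :> R by []; field.
apply: (@le_trans _ _ (y / 2)); last by move: (n.+1%:R^-1) h => a; lra.
by rewrite ler_piMr ?divr_ge0 ?(ltW y0) // invf_le1 // ler1n.
Unshelve. all: by end_near. Qed.


(** * From the characteristic function to the distribution function *)

Section CauchyCharfun.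
Context {d : measure_display} {T : measurableType d} {R : realType}.
Variables (P : probability T R) (X : {RV P >-> R}) (c s : R).
Hypothesis c_gt0 : 0 < c.
Hypothesis EcosE : forall t, 0 < t ->
  \int[P]_w cos (t * X w) = expR (- (c * t)) * cos (t * s).
Hypothesis EsinE : forall t, 0 < t ->
  \int[P]_w sin (t * X w) = expR (- (c * t)) * sin (t * s).

Let measurable_shift (h u : R) : measurable_fun setT (fun w => h * (X w - u)).
Proof. by apply: measurable_funM => //; apply: measurable_funB. Qed.

Let integrable_sin (f : T -> R) : measurable_fun setT f ->
  P.-integrable setT (EFin \o (fun w => sin (f w))).
Proof.
move=> mf; apply: (bounded_integrable _ _ 1) => [|w].
  apply: measurableT_comp => //.
  exact: (continuous_measurable_fun (@continuous_sin R)).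
by rewrite ler_norml sin_geN1 sin_le1.
Qed.

Let integrable_cos (f : T -> R) : measurable_fun setT f ->
  P.-integrable setT (EFin \o (fun w => cos (f w))).
Proof.
move=> mf; apply: (bounded_integrable _ _ 1) => [|w].
  apply: measurableT_comp => //.
  exact: (continuous_measurable_fun (@continuous_cos R)).
by rewrite ler_norml cos_geN1 cos_le1.
Qed.

Let measurable_scale (t : R) : measurable_fun setT (fun w => t * X w).
Proof. exact: measurable_funM. Qed.

(** This is the imaginary part of e^(-itu) E e^(itX): centring at [u] replaces [s] by [s - u]. *)
Lemma integral_sin_shift (t u : R) : 0 < t ->
  \int[P]_w sin (t * (X w - u)) = expR (- (c * t)) * sin (t * (s - u)).
Proof.
move=> t0; under eq_Rintegral do rewrite mulrBr sinB.
rewrite RintegralB //; first last.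
- exact: (integrableZr measurableT (sin (t * u)) (integrable_cos _ (measurable_scale t))).
- exact: (integrableZr measurableT (cos (t * u)) (integrable_sin _ (measurable_scale t))).
rewrite !RintegralZr ?EsinE ?EcosE //; first last.
- exact: integrable_sin.
- exact: integrable_cos.
by rewrite mulrBr sinB; ring.
Qed.

(** The term of frequency n h acquires the factor e^(-cnh) = (e^(-ch))^n, which is absorbed into
    r^n. *)
Lemma integral_poisson_sum (r h u : R) (N : nat) : 0 < h ->
  `|r| < 1 ->
  \int[P]_w poisson_sum r (h * (X w - u)) N =
    poisson_sum (r * expR (- (c * h))) (h * (s - u)) N.
Proof.
move=> h0 r1; elim: N => [|N IH].
  rewrite /poisson_sum big_nil; under eq_Rintegral do rewrite big_nil.
  by rewrite Rintegral_cst // mul0r.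
have E w : poisson_sum r (h * (X w - u)) N.+1 =
    poisson_sum r (h * (X w - u)) N +
    r ^+ N.+1 / N.+1%:R * sin (N.+1%:R * h * (X w - u)).
  by rewrite /poisson_sum big_nat_recr //= mulrA.
under eq_Rintegral do rewrite E.
have isin := integrable_sin _ (measurable_shift (N.+1%:R * h) u).
rewrite RintegralD //; first last.
- exact: (integrableZl measurableT (r ^+ N.+1 / N.+1%:R) isin).
- apply: bounded_integrable; first exact: measurable_poisson_sum.
  by move=> w; exact: norm_poisson_sum_le.
rewrite RintegralZl // integral_sin_shift ?mulr_gt0 // IH.
rewrite [in RHS]/poisson_sum big_nat_recr //=; congr (_ + _).
rewrite exprMn -expRM_natl mulrN [_%:R * (c * h)]mulrCA !mulrA; ring.
Qed.

Lemma integral_poisson_atan (r h u : R) : 0 < h -> `|r| < 1 ->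
  \int[P]_w poisson_atan r (h * (X w - u)) =
    poisson_atan (r * expR (- (c * h))) (h * (s - u)).
Proof.
move=> h0 r1.
have c1 : `|r * expR (- (c * h))| < 1.
  rewrite normrM [X in _ * X]ger0_norm ?expR_ge0 //.
  apply: le_lt_trans r1; rewrite ler_piMr // -expR0 ler_expR.
  by rewrite oppr_le0 mulr_ge0 // ltW.
have h1 := @bounded_cvg_Rintegral _ _ _ P
  (fun N w => poisson_sum r (h * (X w - u)) N)
  (fun w => poisson_atan r (h * (X w - u))) _
  (fun N => measurable_poisson_sum _ r N (measurable_shift h u))
  (fun N w => norm_poisson_sum_le r (h * (X w - u)) N r1)
  (fun w => cvg_poisson_sum r (h * (X w - u)) r1).
apply: (cvg_unique _ h1) => //.
rewrite (_ : (fun N => _) =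
  poisson_sum (r * expR (- (c * h))) (h * (s - u))); last first.
  by apply/funext => N; exact: integral_poisson_sum.
exact: cvg_poisson_sum.
Qed.

(** Take r = e^(-eps h) with h = 1/(n+1). On the right the exponentials multiply to e^(-(eps+c)h),
    so [cvg_poisson_atan] gives the limit on both sides. *)
Lemma integral_atan (eps u : R) : 0 < eps ->
  \int[P]_w atan ((X w - u) / eps) = atan ((s - u) / (eps + c)).
Proof.
move=> e0.
have r1 n : `|expR (- (eps * n.+1%:R^-1))| < 1.
  by rewrite ger0_norm ?expR_ge0 // -expR0 ltr_expR oppr_lt0 mulr_gt0 ?invr_gt0.
have h1 := @bounded_cvg_Rintegral _ _ _ P
  (fun n w => poisson_atan (expR (- (eps * n.+1%:R^-1)))
    (n.+1%:R^-1 * (X w - u)))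
  (fun w => atan ((X w - u) / eps)) _
  (fun n => measurable_poisson_atan _ _ (r1 n) (measurable_shift _ u))
  (fun n w => norm_atan_le _) (fun w => cvg_poisson_atan _ _ e0).
apply: (cvg_unique _ h1) => //.
have := cvg_poisson_atan (eps + c) (s - u) (addr_gt0 e0 c_gt0).
apply: cvg_trans; apply: near_eq_cvg; apply: nearW => n /=.
rewrite integral_poisson_atan ?invr_gt0 // -expRD.
congr (poisson_atan (expR _) _).
by ring.
Qed.

Lemma cdf_of_cauchy_charfun (u : R) :
  cdf X u = (2^-1 + pi^-1 * atan ((u - s) / c))%:E.
Proof.
pose A := X @^-1` `]-oo, u].
have mA : measurable A.
  by rewrite -[A]setTI; apply: (measurable_funPT X).
have atanm : measurable_fun setT (@atan R).
  by apply: continuous_measurable_fun; exact: continuous_atan.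
(* The scale is 1/(n+1)^2 and the point [u] is moved to u + 1/(n+1). Moving to the right puts the
   event X = u on the [- (pi / 2)] side, as the closed ray in [A] requires. *)
have h1 := @bounded_cvg_Rintegral _ _ _ P
  (fun n w => atan ((X w - u - n.+1%:R^-1) / n.+1%:R^-1 ^+ 2))
  (fun w => if X w - u <= 0 then - (pi / 2) else pi / 2) _ _
  (fun n w => norm_atan_le _) (fun w => cvg_atan_step _).
have h2 : atan ((s - u) / c) =
    \int[P]_w (if X w - u <= 0 then - (pi / 2) else pi / 2).
  apply: (cvg_unique _ _ (h1 _)) => //; last first.
    move=> n; apply: measurableT_comp => //.
    by apply: measurable_funM => //; do 2 apply: measurable_funB => //.
  have hs : (s - u - n.+1%:R^-1) / (n.+1%:R^-1 ^+ 2 + c) @[n --> \oo]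
      --> (s - u - 0) / (0 ^+ 2 + c).
    have hh := @cvg_harmonic R.
    apply: cvgM; first by apply: cvgB; [exact: cvg_cst | exact: hh].
    apply: cvgV; first by rewrite expr0n add0r gt_eqF.
    by apply: cvgD; [rewrite expr2; exact: (cvgM hh hh) | exact: cvg_cst].
  rewrite subr0 expr0n /= add0r in hs.
  have := cvg_comp _ _ hs (@continuous_atan _ _).
  apply: cvg_trans; apply: near_eq_cvg; apply: nearW => n /=.
  under eq_Rintegral do rewrite -addrA -opprD.
  by rewrite integral_atan // opprD addrA.
have PA : P A \is a fin_num by exact: fin_num_measure.
have h3 : atan ((s - u) / c) = pi / 2 - pi * fine (P A).
  rewrite h2.
  under eq_Rintegral => w _.
    (* Writing the two-valued limit as an affine function of the indicator of [A] turns its integral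
       into a formula in [P A]. *)
    rewrite (_ : (if _ then _ else _) = pi / 2 - pi * \1_A w); last first.
      rewrite indicE subr_le0.
      have -> : (w \in A) = (X w <= u).
        by apply/idP/idP; rewrite /A inE /= in_itv.
      by case: ifP => _ /=; [rewrite mulr1; field | rewrite mulr0 subr0].
    over.
  have i1 : P.-integrable setT (EFin \o (\1_A : T -> R)).
    by apply: integrable_indic.
  rewrite RintegralB //; last exact: (integrableZl measurableT pi i1).
  - rewrite Rintegral_cst // [X in fine X](probability_setT P) mulr1.
    rewrite RintegralZl //.
    by rewrite /Rintegral integral_indic // setIT.
  - by apply: (bounded_integrable P (fun=> pi / 2) `|pi / 2|).
rewrite (_ : cdf X u = P A) //.
rewrite -(fineK PA); congr EFin.
have pi0 : pi != 0 :> R by rewrite gt_eqF // pi_gt0.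
by rewrite -[u - s]opprB mulNr atanN h3; move: pi pi0 => p p0; field.
Qed.

End CauchyCharfun.

Theorem mainTheorem6 (R : realType) (theta x : R)
    (theta_gt : -1 < theta) (theta_lt : theta < 1)
    (x_gt : -1 < x) (x_lt : x < 1) :
  (forall (d : measure_display) (T : measurableType d) (P : probability T R)
      (X : {RV P >-> R}),
    (forall t : R, charfun X t = stable1_charfun theta t) ->
    forall y : R, cdf X y = (stable1_df theta y)%:E)
  /\
  ((1 - theta) / 2
     + pi^-1 * \sum_(0 <= n < N)
         (x ^+ n.+1 / n.+1%:R * sin (pi / 2 * n.+1%:R * (1 - theta))))
    @[N --> \oo] --> stable1_df theta x.
Proof.
set alpha := pi / 2 * theta.
have pi0 : 0 < pi :> R by exact: pi_gt0.
have alpha_in : - (pi / 2) < alpha < pi / 2.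
  have -> : alpha = theta * (pi / 2) by rewrite /alpha mulrC.
  by rewrite -mulN1r ltr_pM2r ?divr_gt0 // theta_gt gtr_pMl ?divr_gt0.
split=> [d T P X hX y|].
  apply: cdf_of_cauchy_charfun => [|t t0|t t0]; first exact: cos_gt0_pihalf.
    by rewrite -Re_charfun hX stable1_charfunE.
  by rewrite -Im_charfun hX stable1_charfunE.
have x1 : `|x| < 1 by rewrite ltr_norml x_gt.
(* The shift [alpha] in [poisson_atanE] contributes alpha/pi = theta/2, which turns the constant 1/2
   into (1 - theta)/2. *)
have -> : stable1_df theta x =
    (1 - theta) / 2 + pi^-1 * poisson_atan x (pi / 2 - alpha).
  rewrite poisson_atanE // /stable1_df /alpha.
  by move: pi pi0 (atan _) => p p0 a; field; rewrite gt_eqF.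
apply: cvgD; first exact: cvg_cst.
apply: cvgMr; have := cvg_poisson_sum x (pi / 2 - alpha) x1.
apply: cvg_trans; apply: near_eq_cvg; apply: nearW => N.
apply: eq_bigr => n _; congr (_ * sin _).
by rewrite /alpha; ring.
Qed.
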